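(* Let $q$ be a prime power and $F,G \subset \mathbb{F}_q^2$ with $0\notin F$. For $t\in \mathbb{F}_q$ let $$\nu(t)=|\{(x,y) \in F \times G: x \cdot y=t \}|,$$ where $x \cdot y=x_1y_1+x_2y_2$. Then $$\sum_{t\in\mathbb{F}_q} \nu^2(t) \leq |F|^2 |G|^2 q^{-1}+q |F| |G| \cdot \max_{x\neq 0}|F\cap l_x|,$$ where for $x \in \mathbb{F}_q^2\setminus\{0\}$, $l_x=\{sx: s \in \mathbb{F}_q \setminus\{0\}\}$. *)

(* Defs.v *)
From HB Require Import structures.
From mathcomp Require Import all_boot all_order all_algebra.
Set Implicit Arguments.
Unset Strict Implicit.
Unset Printing Implicit Defensive.
Import GRing.Theory.
Local Open Scope ring_scope.

Section DotProductCount.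

Variable K : finFieldType.

Definition dot (x y : 'rV[K]_2) : K := x 0 0 * y 0 0 + x 0 1 * y 0 1.

Definition nu (F G : {set 'rV[K]_2}) (t : K) : nat :=
  #|[set p in setX F G | dot p.1 p.2 == t]|.

Definition punctured_line (x : 'rV[K]_2) : {set 'rV[K]_2} :=
  [set s *: x | s in [set s : K | s != 0]].

End DotProductCount.

(* Main.v *)
Require Import Defs.
From HB Require Import structures.
From mathcomp Require Import all_boot all_order all_algebra.
From mathcomp Require Import ring lra.
Set Implicit Arguments.
Unset Strict Implicit.
Unset Printing Implicit Defensive.
Import Order.TTheory GRing.Theory Num.Theory.
Local Open Scope ring_scope.

(** For [x != 0] let [E x] be the number of pairs [(y, y')] in [G * G] with
    [x . (y - y') = 0], i.e. the second moment of [t |-> #{y in G | x . y = t}],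
    and let [V x = E x - |G|^2 / q].  Cauchy-Schwarz over [x] in [F] bounds the
    sum of [nu^2] by [|F|] times the sum of [E] over [F], so it remains to
    bound the sum of [V] over [F].  Now [V >= 0] (Cauchy-Schwarz over [t]), [V]
    is constant on punctured lines, and a double count gives exactly
    [q (q - 1) |G|] for the sum of [V] over the whole plane.  Averaging [V]
    over the [q - 1] dilates of each point of [F] hits each [z != 0] at most
    [max |F :&: l_x|] times.  This replaces Fourier analysis by counting. *)

(** Cauchy-Schwarz against the constant 1: with both sides expanded as double sums over [i] and [j],
    it holds termwise, as [a i * a j <= (a i ^+ 2 + a j ^+ 2) / 2]. *)
Lemma sqr_sum_le (R : realFieldType) (I : finType) (A : {pred I}) (a : I -> R) :
  (\sum_(i in A) a i) ^+ 2 <= #|A|%:R * \sum_(i in A) a i ^+ 2.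
Proof.
have -> : #|A|%:R * \sum_(i in A) a i ^+ 2
    = \sum_(i in A) \sum_(j in A) (a i ^+ 2 + a j ^+ 2) / 2.
  under [RHS]eq_bigr => i _ do
    rewrite -mulr_suml big_split /= sumr_const.
  rewrite -mulr_suml big_split /= sumrMnl sumr_const -[_ *+ #|A|]mulr_natl.
  by field.
rewrite expr2 big_distrlr /=; apply: ler_sum => i _; apply: ler_sum => j _.
by have := sqr_ge0 (a i - a j); nra.
Qed.

Section Energy.

Variables (K : finFieldType) (G : {set 'rV[K]_2}).
Implicit Types (x y z w : 'rV[K]_2) (s t : K).

Local Notation q := (#|K|%:R : rat).

Lemma dotZl s x y : dot (s *: x) y = s * dot x y.
Proof. by rewrite /dot !mxE; ring. Qed.

Lemma dotBr x y z : dot x (y - z) = dot x y - dot x z.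
Proof. by rewrite /dot !mxE; ring. Qed.

Lemma row2_eq x y : x 0 0 = y 0 0 -> x 0 1 = y 0 1 -> x = y.
Proof.
move=> e0 e1; apply/rowP => i.
by have [->|->] : i = 0 \/ i = 1
  by case: i => [[|[|//]] lti]; [left|right]; apply: val_inj.
Qed.

Lemma row2_neq0 x : (x != 0) = (x 0 0 != 0) || (x 0 1 != 0).
Proof.
rewrite -negb_and; congr (~~ _); apply/eqP/andP => [->|[/eqP e0 /eqP e1]].
  by rewrite !mxE eqxx.
by apply: row2_eq; rewrite mxE.
Qed.

(** The orthogonal of [w] is the line spanned by [v], which is [w] rotated by a quarter turn, and
    [c *: v] determines [c] because [v] is nonzero. *)
Lemma card_dot_eq0 w : w != 0 -> #|[set x | dot x w == 0]| = #|K|.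
Proof.
move=> w0.
pose v : 'rV[K]_2 := \row_j (if j == 0 then w 0 1 else - w 0 0).
have v0E : v 0 0 = w 0 1 by rewrite mxE.
have v1E : v 0 1 = - w 0 0 by rewrite mxE.
have v0 : v != 0 by rewrite row2_neq0 v0E v1E oppr_eq0 orbC -row2_neq0.
have -> : [set x | dot x w == 0] = [set c *: v | c in [set: K]].
  apply/setP=> x; rewrite inE; apply/eqP/imsetP => [|[c _ ->]]; last first.
    by rewrite dotZl /dot v0E v1E; ring.
  rewrite /dot => /eqP; rewrite addr_eq0 => /eqP e.
  move: w0; rewrite row2_neq0 => /orP[a0|b0].
    (* The scalar is read off the coordinate of [v] known to be nonzero; the orthogonality relation
       [e] then gives the other coordinate. *)
    exists (- (x 0 1 / w 0 0)) => //.
    apply: row2_eq; rewrite mxE ?v0E ?v1E; last by field.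
    by apply: (mulIf a0); rewrite e; field.
  exists (x 0 0 / w 0 1) => //.
  apply: row2_eq; rewrite mxE ?v0E ?v1E; first by field.
  apply: (mulIf b0); rewrite -[LHS]opprK -e; field.
  exact: b0.
by rewrite card_imset ?cardsT // => c d /eqP;
  rewrite -subr_eq0 -scalerBl scaler_eq0 (negPf v0) orbF subr_eq0 => /eqP.
Qed.

Definition fiber x t : {set 'rV[K]_2} := [set y in G | dot x y == t].

Definition energy x : rat := \sum_t #|fiber x t|%:R ^+ 2.

(** The subtracted term is the energy of a set spread evenly over the [q] fibers, namely
    [q * (#|G| / q) ^+ 2]. *)
Definition excess x : rat := energy x - #|G|%:R ^+ 2 / q.

Lemma energyE x :
  energy x = \sum_(y in G) \sum_(z in G) (dot x (y - z) == 0)%:R.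
Proof.
have fE t : #|fiber x t|%:R = \sum_(y in G) (dot x y == t)%:R :> rat.
  rewrite -sum1_card natr_sum (eq_bigl _ _ (fun y => in_set _ y)) big_mkcondr.
  by apply: eq_bigr => y _; case: eqP.
rewrite /energy.
under eq_bigr => t _ do rewrite fE expr2 big_distrlr /=.
rewrite exchange_big; apply: eq_bigr => y _.
rewrite exchange_big; apply: eq_bigr => z _.
rewrite (bigD1 (dot x y)) //= eqxx mul1r big1 => [|t /negPf ty].
  by rewrite addr0 dotBr subr_eq0 eq_sym.
by rewrite eq_sym ty mul0r.
Qed.

Lemma excessZ s x : s != 0 -> excess (s *: x) = excess x.
Proof.
move=> s0; rewrite /excess !energyE; congr (_ - _).
by apply: eq_bigr => y _; apply: eq_bigr => z _;
  rewrite dotZl mulf_eq0 (negPf s0).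
Qed.

Lemma cardK_gt0 : 0 < q.
Proof. by rewrite ltr0n; apply/card_gt0P; exists 0. Qed.

Lemma sum_fiber x : \sum_t #|fiber x t|%:R = #|G|%:R :> rat.
Proof.
rewrite -natr_sum; congr _%:R.
rewrite -sum1_card (partition_big (dot x) predT) //=.
apply: eq_bigr => t _; rewrite -sum1_card.
by apply: eq_bigl => y; rewrite inE.
Qed.

Lemma excess_ge0 x : 0 <= excess x.
Proof.
rewrite subr_ge0 ler_pdivrMr ?cardK_gt0 // mulrC -(sum_fiber x).
exact: (sqr_sum_le predT).
Qed.

(** After exchanging the sums, a pair [(y, z)] contributes the number of [x] orthogonal to [y - z]:
    all [q ^+ 2] vectors on the diagonal, a line of [q] vectors off it. *)
Lemma sum_energy :
  \sum_x energy x = q * (q - 1) * #|G|%:R + q * #|G|%:R ^+ 2.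
Proof.
under eq_bigr => x _ do rewrite energyE.
rewrite exchange_big /=.
have -> : q * (q - 1) * #|G|%:R + q * #|G|%:R ^+ 2
    = \sum_(y in G) (q * (q - 1) + q * #|G|%:R).
  by rewrite sumr_const -mulr_natl; ring.
apply: eq_bigr => y yG; rewrite exchange_big /=.
(* Both cases at once: the diagonal has [q ^+ 2 - q = q * (q - 1)] more vectors. *)
have cE z : \sum_x (dot x (y - z) == 0)%:R
    = q + (y == z)%:R * (q * (q - 1)) :> rat.
  rewrite -natr_sum; have -> : (\sum_x (dot x (y - z) == 0%R))%N
     = #|[set x | dot x (y - z) == 0]|.
    rewrite -sum1_card (eq_bigl _ _ (fun y => in_set _ y)) [RHS]big_mkcond.
    by apply: eq_bigr => x _; case: eqP.
  have [<-|yz] := eqVneq y z.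
    have -> : [set x | dot x (y - y) == 0] = setT.
      by apply/setP => x; rewrite !inE subrr /dot !mxE !mulr0 addr0 eqxx.
    by rewrite cardsT card_mx mul1n natrX ?eqxx mul1r; ring.
  by rewrite card_dot_eq0 ?subr_eq0 // mul0r addr0.
under eq_bigr => z _ do rewrite cE.
rewrite big_split /= sumr_const -[_ *+ #|G|]mulr_natl.
rewrite (bigD1 y) //= eqxx big1 => [|z].
  by rewrite mul1r; ring.
by case/andP=> _ /negPf; rewrite eq_sym => ->; rewrite mul0r.
Qed.

Lemma sum_excess : \sum_x excess x = q * (q - 1) * #|G|%:R.
Proof.
rewrite sumrB sum_energy sumr_const card_mx mul1n -[_ *+ (_ ^ _)]mulr_natl.
rewrite natrX.
have := cardK_gt0; set r := q => r0.
by field; rewrite gt_eqF.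
Qed.

End Energy.

Section Averaging.

Variables (K : finFieldType) (F : {set 'rV[K]_2}).
Hypothesis F0 : 0 \notin F.

Local Notation q := (#|K|%:R : rat).

(** A point [x] of [F] is nonzero, so at most one [s] sends it to [z]; if one does, [x = s^-1 *: z]
    lies on the punctured line of [z]. *)
Lemma card_dilates (z : 'rV[K]_2) :
  (\sum_(x in F) \sum_(s | s != 0%R) (s *: x == z)
     <= #|F :&: punctured_line z|)%N.
Proof.
rewrite -sum1_card; under [leqRHS]eq_bigl => x do rewrite in_setI.
rewrite [leqRHS]big_mkcondr /=.
apply: leq_sum => x xF; have x0 : x != 0 by apply: contraNneq F0 => <-.
case: (pickP (fun s => (s != 0) && (s *: x == z))) => [s /andP[s0 /eqP sx]|no].
  have -> : x \in punctured_line z.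
    apply/imsetP; exists s^-1; first by rewrite inE invr_eq0.
    by rewrite -sx scalerA mulVf // scale1r.
  rewrite (bigD1 s) //= sx eqxx big1 // => u /andP[_ us].
  rewrite -sx -subr_eq0 -scalerBl scaler_eq0 subr_eq0 (negPf us).
  by rewrite (negPf x0).
by rewrite big1 // => s s0; have := no s; rewrite s0 /= => ->.
Qed.

Lemma sum_line_invariant_le (M : nat) (V : 'rV[K]_2 -> rat) :
    (forall z, z != 0 -> (#|F :&: punctured_line z| <= M)%N) ->
    (forall x, 0 <= V x) -> (forall s x, s != 0 -> V (s *: x) = V x) ->
  (q - 1) * \sum_(x in F) V x <= M%:R * \sum_x V x.
Proof.
move=> leM V_ge0 VZ.
have -> : (q - 1) * \sum_(x in F) V x
    = \sum_(x in F) \sum_(s | s != 0) \sum_z (s *: x == z)%:R * V z.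
  rewrite mulr_sumr; apply: eq_bigr => x xF.
  transitivity (\sum_(s : K | s != 0) V x).
    rewrite sumr_const -[RHS]mulr_natl (cardC1 0); congr (_ * _).
    have := cardK_gt0 K; rewrite ltr0n; case: #|K| => // n _.
    by rewrite -natr1 addrK.
  apply: eq_bigr => s s0; rewrite (bigD1 (s *: x)) //= eqxx mul1r VZ //.
  by rewrite big1 ?addr0 // => z; rewrite eq_sym => /negPf->; rewrite mul0r.
under eq_bigr => x _ do rewrite exchange_big /=.
rewrite exchange_big /= mulr_sumr; apply: ler_sum => z _.
under eq_bigr => x _ do rewrite -mulr_suml -natr_sum.
rewrite -mulr_suml -natr_sum; apply: ler_wpM2r => //.
rewrite ler_nat; have [->|z0] := eqVneq z 0; last first.
  exact: leq_trans (card_dilates z) (leM z z0).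
(* The bound [leM] says nothing about [z = 0], but there the count is zero: nonzero dilates of
   points of [F] avoid the origin. *)
rewrite big1 // => x xF; rewrite big1 // => s s0.
rewrite scaler_eq0 (negPf s0) /=.
by apply/eqP; rewrite eqb0; apply: contraNneq F0 => <-.
Qed.

End Averaging.

Lemma nu_sum (K : finFieldType) (F G : {set 'rV[K]_2}) (t : K) :
  nu F G t = (\sum_(x in F) #|fiber G x t|)%N.
Proof.
rewrite /nu -sum1_card.
under [RHS]eq_bigr => x _ do rewrite -sum1_card.
rewrite pair_big_dep /=; apply: eq_bigl => -[x y].
by rewrite !inE /= andbA.
Qed.

Theorem theorem3p1 (q : nat) (K : finFieldType) (hq : #|K| = q)
    (F G : {set 'rV[K]_2}) (hF : 0 \notin F) :
  \sum_(t : K) (nu F G t)%:R ^+ 2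
    <= #|F|%:R ^+ 2 * #|G|%:R ^+ 2 * q%:R^-1
       + q%:R * #|F|%:R * #|G|%:R
         * (\max_(x : 'rV[K]_2 | x != 0) #|F :&: punctured_line x|)%:R
    :> rat.
Proof.
subst q.
have leM (z : 'rV[K]_2) : z != 0 ->
    (#|F :&: punctured_line z|
       <= \max_(x : 'rV[K]_2 | x != 0%R) #|F :&: punctured_line x|)%N.
  by move=> z0; rewrite (bigD1 z) //= leq_maxl.
move: leM; set M := bigop _ _ _ => leM.
have q1 : 1 < #|K|%:R :> rat.
  rewrite ltr1n -cardsT (cardsD1 0) inE (cardsD1 1) !inE oner_eq0 //.
(* Cauchy-Schwarz over [F] for each fixed [t], applied to the fiber sizes. *)
have leE : \sum_t (nu F G t)%:R ^+ 2 <= #|F|%:R * \sum_(x in F) energy G x.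
  rewrite exchange_big mulr_sumr; apply: ler_sum => t _.
  by rewrite nu_sum natr_sum sqr_sum_le.
have leV : \sum_(x in F) excess G x <= #|K|%:R * #|G|%:R * M%:R.
  have := sum_line_invariant_le hF leM (excess_ge0 G) (@excessZ _ G).
  rewrite sum_excess => h.
  rewrite -(ler_pM2l (_ : 0 < #|K|%:R - 1)) ?subr_gt0 //.
  by apply: le_trans h _; rewrite le_eqVlt; apply/predU1P; left; ring.
apply: le_trans leE _.
(* The even-distribution part of the energy yields the main term, the excess yields the error
   term. *)
have -> : \sum_(x in F) energy G x
    = \sum_(x in F) excess G x + #|F|%:R * (#|G|%:R ^+ 2 / #|K|%:R).
  by rewrite sumrB sumr_const -[_ *+ #|F|]mulr_natl subrK.
rewrite mulrDr addrC; apply: lerD.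
  by rewrite !mulrA -expr2.
rewrite -[X in _ <= X * _ * _]mulrC -!mulrA.
by apply: ler_wpM2l; rewrite ?ler0n // mulrA.
Qed.
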